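(* Let $\mathcal{C}\subseteq\mathbb{R}^n$ be a polytope and let $f\colon\mathcal{C}\to\mathbb{R}$ be convex and continuously differentiable in an open set containing $\mathcal{C}$. Suppose that $x^*=\operatorname{argmin}_{x\in\mathcal{C}}f(x)$ is unique, and let $\mathcal{C}^*$ be the unique face of $\mathcal{C}$ such that $x^*$ lies in the relative interior of $\mathcal{C}^*$. Suppose that $\nabla f$ is $L$-Lipschitz continuous on $\mathcal{C}$ with respect to $\|\cdot\|_{\mathcal{C}}$ and that $f$ satisfies a $(\mu,\theta)$-Hölderian error bound with respect to $\|\cdot\|_{\mathcal{C}}$ for some $L>0$, $\mu>0$, and $\theta\in(0,1/2]$. Let $(x_t)_{t\in\mathbb{N}}$ be the iterates of the Frank-Wolfe algorithm with step-sizes $\eta_t=\frac{\ell}{t+\ell}$ for some integer $\ell\ge 2$, and suppose that there exists $Q\in\mathbb{N}$ such that $$\operatorname{argmin}_{y\in\mathcal{C}}\langle\nabla f(x_t),y\rangle\subseteq\mathcal{C}^*\quad\text{for all integers }t\ge Q.$$ Let $B$ and $\rho$ be the constants defined in the context, and let $$m=\frac{\rho}{2^{2-\theta}\mu},\qquad M=\max\left\{\frac{m}{\eta_Q}(4B)^{1-\theta},\ 2\,\frac{2L+B}{\eta_Q},\ 4L\right\},\qquad S=\max\left\{1,\left\lceil\frac{2^{1/\theta}\ell M}{m^{1/\theta}}-\ell\right\rceil,Q\right\}.$$ Then, for all integers $t\ge S$, $$\mathrm{subopt}_t\le\max\left\{\mathrm{subopt}_S\left(\frac{\eta_{t-1}}{\eta_{S-1}}\right)^{\ell},\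 \eta_{t-1}^{\min\{\ell,\frac{1}{1-\theta},2\}}\left(\left(\frac{M}{m}\right)^{\frac{1}{1-\theta}}+\frac{M}{2}\right)\right\}=\mathcal{O}\left(t^{-\frac{1}{1-\theta}}\right).$$
   Context: $\mathbb{N}=\{0,1,2,\ldots\}$. Frank-Wolfe algorithm for $\min_{x\in\mathcal{C}}f(x)$ with step-sizes $\eta_t\in[0,1]$: given any $x_0\in\mathcal{C}$, for $t=0,1,2,\ldots$ choose any $v_t\in\operatorname{argmin}_{v\in\mathcal{C}}\langle\nabla f(x_t),v-x_t\rangle$ and set $x_{t+1}=x_t+\eta_t(v_t-x_t)$. For the iterates, $\mathrm{subopt}_t=f(x_t)-\min_{y\in\mathcal{C}}f(y)$. $\mathcal{C}$-norm: for $x\in\operatorname{span}(\mathcal{C}-\mathcal{C})$, $\|x\|_{\mathcal{C}}=\inf\{\lambda>0: x=\frac{\lambda}{2}(u-v)\text{ for some }u,v\in\mathcal{C}\}$. Standing assumption: $\operatorname{span}(\mathcal{C}-\mathcal{C})=\mathbb{R}^n$. $\|\cdot\|_{\mathcal{C},*}$ denotes the dual norm. $\nabla f$ is $L$-Lipschitz continuous on $\mathcal{C}$ with respect to $\|\cdot\|_{\mathcal{C}}$ if $\|\nabla f(x)-\nabla f(y)\|_{\mathcal{C},*}\le L\|x-y\|_{\mathcal{C}}$ for all $x,y\in\mathcal{C}$. $(\mu,\theta)$-Hölderian error bound with respect to $\|\cdot\|$: for all $x\in\mathcal{C}$, $\mu\,(f(x)-\min_{\mathcal{C}}f)^{\theta}\ge\min_{y\in\operatorname{argmin}_{z\in\mathcal{C}}f(z)}\|x-y\|$.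 For $x\in\mathcal{C}$ let $\bar x\in\operatorname{argmin}_{y\in\mathcal{C}^*}\|x-y\|_{\mathcal{C}}$ (a fixed choice of nearest point of $\mathcal{C}^*$). Define $$B=\sup_{y\in\mathcal{C},\,x\in\mathcal{C}\setminus\mathcal{C}^*}\frac{|\langle\nabla f(y),x-\bar x\rangle|}{\|x-\bar x\|_{\mathcal{C}}}<\infty,\qquad \rho=\min\{\|x-x^*\|_{\mathcal{C}}\mid x\in\text{relative boundary of }\mathcal{C}^*\}>0,$$ where $B=0$ if $\mathcal{C}^*=\mathcal{C}$, and where it is implicit in the definition of $\rho$ that the relative boundary of $\mathcal{C}^*$ is nonempty, i.e. $\mathcal{C}^*$ is not a single vertex. *)

(* Defs.v *)
From HB Require Import structures.
From mathcomp Require Import all_boot all_order all_algebra.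
From mathcomp Require Import all_classical all_reals all_analysis.

Set Implicit Arguments.
Unset Strict Implicit.
Unset Printing Implicit Defensive.

Import Order.TTheory GRing.Theory Num.Theory.
Import numFieldNormedType.Exports.

Local Open Scope classical_set_scope.
Local Open Scope ring_scope.

Section Optimization.
Context {R : realType}.

Definition argmin {T : Type} (A : set T) (g : T -> R) : set T :=
  [set x | A x /\ forall y, A y -> g x <= g y].

(* [inf] is the library's total real infimum (equal to 0 on sets that are empty
   or unbounded below). It is only applied below to continuous functions on
   nonempty compact sets, where it is an attained minimum. *)
Definition minval {T : Type} (A : set T) (g : T -> R) : R :=
  inf [set g y | y in A].

End Optimization.

Section ConvexGeometry.
Context {R : realType} {n : nat}.
Implicit Types (A C F : set 'rV[R]_n) (x y c : 'rV[R]_n).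

Definition dot x y : R := (x *m y^T) 0 0.

Definition linear_span A : set 'rV[R]_n :=
  [set x | exists (k : nat) (w : 'I_k -> R) (p : 'I_k -> 'rV[R]_n),
     (forall i, A (p i)) /\ x = \sum_i w i *: p i].

Definition affine_hull A : set 'rV[R]_n :=
  [set x | exists (k : nat) (w : 'I_k -> R) (p : 'I_k -> 'rV[R]_n),
     [/\ forall i, A (p i), \sum_i w i = 1 & x = \sum_i w i *: p i]].

Definition relint A : set 'rV[R]_n :=
  [set x | A x /\ \forall y \near x, affine_hull A y -> A y].

Definition relbd A : set 'rV[R]_n := closure A `\` relint A.

Definition polytope C : Prop :=
  exists (k : nat) (p : 'I_k -> 'rV[R]_n),
    C = [set x | exists w : 'I_k -> R,
           [/\ forall i, 0 <= w i, \sum_i w i = 1 & x = \sum_i w i *: p i]].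

(* Faces cut out by valid inequalities; [c = 0], [b = 0] gives [C] itself. *)
Definition face C F : Prop :=
  exists (c : 'rV[R]_n) (b : R),
    (forall x, C x -> dot c x <= b) /\ F = [set x | C x /\ dot c x = b].

Definition set_diff A : set 'rV[R]_n := [set u - v | u in A & v in A].

Definition Cnorm C x : R :=
  inf [set lambda : R | 0 < lambda /\
         exists u v, [/\ C u, C v & x = (lambda / 2) *: (u - v)]].

Definition dual_norm (N : 'rV[R]_n -> R) (g : 'rV[R]_n) : R :=
  sup [set dot g x | x in [set x | N x <= 1]].

End ConvexGeometry.

Section FrankWolfe.
Context {R : realType} {n : nat}.
Implicit Types (C Cs : set 'rV[R]_n) (f : 'rV[R]_n -> R).

Definition grad f (x : 'rV[R]_n) : 'rV[R]_n :=
  \row_(i < n) 'D_(delta_mx 0 i) f x.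

Definition C1_around C f : Prop :=
  exists U : set 'rV[R]_n,
    [/\ open U, C `<=` U, forall x, U x -> differentiable f x
      & forall x, U x -> {for x, continuous (grad f)}].

Definition lipschitz_grad C f (L : R) : Prop :=
  forall x y, C x -> C y ->
    dual_norm (Cnorm C) (grad f x - grad f y) <= L * Cnorm C (x - y).

Definition holder_error_bound C f (N : 'rV[R]_n -> R) (mu theta : R) : Prop :=
  forall x, C x ->
    minval (argmin C f) (fun y => N (x - y))
      <= mu * (f x - minval C f) `^ theta.

Definition frank_wolfe C f (eta : nat -> R) (x v : nat -> 'rV[R]_n) : Prop :=
  C (x 0%N) /\
  forall t, argmin C (fun w => dot (grad f (x t)) (w - x t)) (v t) /\
            x t.+1 = x t + eta t *: (v t - x t).

Definition subopt C f (x : nat -> 'rV[R]_n) (t : nat) : R :=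
  f (x t) - minval C f.

Definition stepsize (l t : nat) : R := l%:R / (t + l)%:R.

Definition nearest_selection C Cs (bar : 'rV[R]_n -> 'rV[R]_n) : Prop :=
  forall x, C x -> argmin Cs (fun y => Cnorm C (x - y)) (bar x).

(* The supremum is over a bounded set: [grad f] is continuous on the compact
   set [C], and all norms on R^n are equivalent. *)
Definition constB C Cs f (bar : 'rV[R]_n -> 'rV[R]_n) : R :=
  if `[< Cs = C >] then 0
  else sup [set `|dot (grad f y) (x - bar x)| / Cnorm C (x - bar x)
             | y in C & x in C `\` Cs].

Definition const_rho C Cs (xs : 'rV[R]_n) : R :=
  minval (relbd Cs) (fun x => Cnorm C (x - xs)).

End FrankWolfe.

(* Main.v *)
Require Import Defs.
From HB Require Import structures.
From mathcomp Require Import all_boot all_order all_algebra.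
From mathcomp Require Import all_classical all_reals all_analysis.
From mathcomp Require Import ring lra.

Set Implicit Arguments.
Unset Strict Implicit.
Unset Printing Implicit Defensive.

Import Order.TTheory GRing.Theory Num.Theory.
Import numFieldNormedType.Exports.

Local Open Scope classical_set_scope.
Local Open Scope ring_scope.

(* Write h_t for the primal gap, eta_t for the step-size and p = 1 / (1 - theta).
   Smoothness gives h_{t+1} <= h_t - eta_t gap_t + 2 L eta_t^2, where
   gap_t = <grad f (x_t), x_t - v_t> >= h_t. If m h_t^(1-theta) <= M eta_t, then
   h_{t+1} <= eta_t^p ((M/m)^p + M/2). Otherwise h_{t+1} <= (1 - eta_t) h_t:
   since the vertices v_t lie in the face Cs from step Q on, the distance of x_t
   to its nearest point xb of Cs is at most 2 (eta_t / eta_Q)^2, so it costs at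
   most half of h_t; the point xs - s (xb - xs) belongs to Cs as long as
   s ||xb - xs|| <= rho, and comparing v_t with it gives
   gap_t >= h_t + s h_t / 2, where the error bound ||xb - xs|| <= 2 mu h_t^theta
   allows s = rho / (2 mu h_t^theta). Both alternatives propagate the
   announced bound, because 1 - eta_t <= (eta_t / eta_{t-1})^l by Bernoulli. *)

(** * The norm induced by [C] and its dual norm *)

Section CNormTheory.
Context {R : realType} {n : nat}.
Implicit Types (C : set 'rV[R]_n) (g x y u v : 'rV[R]_n).

Lemma dotE x y : dot x y = \sum_i x 0 i * y 0 i.
Proof. by rewrite /dot mxE; apply: eq_bigr => i _; rewrite mxE. Qed.

Lemma dotDr g x y : dot g (x + y) = dot g x + dot g y.
Proof. by rewrite /dot linearD mulmxDr mxE. Qed.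

Lemma dotNr g x : dot g (- x) = - dot g x.
Proof. by rewrite /dot linearN mulmxN mxE. Qed.

Lemma dotBr g x y : dot g (x - y) = dot g x - dot g y.
Proof. by rewrite dotDr dotNr. Qed.

Lemma dotZr g (a : R) x : dot g (a *: x) = a * dot g x.
Proof. by rewrite /dot linearZ -scalemxAr mxE. Qed.

Lemma dotBl g x y : dot (x - y) g = dot x g - dot y g.
Proof. by rewrite /dot mulmxBl !mxE. Qed.

Lemma ler_norm_coord x i : `|x 0 i| <= `|x|.
Proof.
rewrite [leRHS](_ : _ = mx_norm x)// mx_normrE.
by apply: (le_bigmax_cond _ (fun ij : 'I_1 * 'I_n => `|x ij.1 ij.2|) (j := (0, i))).
Qed.

Lemma dot_le_norm g x : dot g x <= (\sum_i `|g 0 i|) * `|x|.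
Proof.
rewrite dotE mulr_suml; apply: ler_sum => i _.
apply: le_trans (ler_norm _) _; rewrite normrM ler_wpM2l//.
exact: ler_norm_coord.
Qed.

Definition segment_closed C := forall x y (s : R),
  C x -> C y -> 0 <= s <= 1 -> C ((1 - s) *: x + s *: y).

Definition norm_bounded C := exists2 D : R, 0 < D & forall x, C x -> `|x| <= D.

Definition Cnorm_scale C x : set R := [set lambda : R | 0 < lambda /\
  exists u v, [/\ C u, C v & x = (lambda / 2) *: (u - v)]].

(** Keeps the infimum in [Cnorm] off the empty set, where [inf] defaults to 0. *)
Definition Cnorm_total C := forall x, Cnorm_scale C x !=set0.

Lemma Cnorm_ge0 C x : 0 <= Cnorm C x.
Proof.
rewrite /Cnorm -/(Cnorm_scale C x).
have [->|/set0P E0] := eqVneq (Cnorm_scale C x) set0; first by rewrite inf0.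
by apply: lb_le_inf => // s [/ltW].
Qed.

Lemma Cnorm_le C x u v (lambda : R) : 0 < lambda -> C u -> C v ->
  x = (lambda / 2) *: (u - v) -> Cnorm C x <= lambda.
Proof.
move=> l0 Cu Cv xE; apply: ge_inf; last by split=> //; exists u, v.
by exists 0 => s [/ltW].
Qed.

Lemma Cnorm_sub_le C u v (a : R) : C u -> C v -> 0 <= a ->
  Cnorm C (a *: (u - v)) <= 2 * a.
Proof.
move=> Cu Cv; rewrite le_eqVlt => /predU1P[<-|a0].
  (* The scales in [Cnorm] are strictly positive, so at [a = 0] the value 0 is only approached, by
     writing 0 as a multiple of [u - u] with arbitrarily small scale [e]. *)
  apply/ler_addgt0Pr => e e0; apply: (@Cnorm_le _ _ u u) => //; first by lra.
  by rewrite subrr scaler0 scale0r.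
apply: (@Cnorm_le _ _ u v) => //; first by lra.
by congr (_ *: _); field.
Qed.

Lemma Cnorm_adherent C x (e : R) : Cnorm_scale C x !=set0 -> 0 < e ->
  exists lambda u v, [/\ 0 < lambda, lambda < Cnorm C x + e, C u, C v
    & x = (lambda / 2) *: (u - v)].
Proof.
move=> E0 e0; have := @inf_lt _ (Cnorm_scale C x) (Cnorm C x + e) E0.
case; first by rewrite /Cnorm ltrDl.
by move=> s [s0 [u [v [Cu Cv xE]]]] slt; exists s, u, v.
Qed.

(** By convexity, [a / 2] times [u - u'] plus [b / 2] times [v - v'] is [(a + b) / 2] times a
    difference of two points of [C], combined with weights [a / (a + b)] and [b / (a + b)]. The
    slack [e] makes attainment of the infima unnecessary. *)
Lemma CnormD C x y : segment_closed C -> Cnorm_total C ->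
  Cnorm C (x + y) <= Cnorm C x + Cnorm C y.
Proof.
move=> Cc Ct; apply/ler_addgt0Pr => e e0; have e2 : 0 < e / 2 by lra.
have [a [u [u' [a0 alt Cu Cu' xE]]]] := Cnorm_adherent (Ct x) e2.
have [b [v [v' [b0 blt Cv Cv' yE]]]] := Cnorm_adherent (Ct y) e2.
have ab0 : 0 < a + b by lra.
have s01 : 0 <= b / (a + b) <= 1.
  apply/andP; split; first by apply: divr_ge0; exact: ltW.
  by rewrite ler_pdivrMr// mul1r lerDr ltW.
apply: (@le_trans _ _ (a + b)); last by lra.
apply: (Cnorm_le ab0 (Cc _ _ _ Cu Cv s01) (Cc _ _ _ Cu' Cv' s01)).
by rewrite xE yE; apply/rowP => i; rewrite !mxE; field; lra.
Qed.

Lemma CnormZ_le C x (a : R) : Cnorm_total C -> 0 < a ->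
  Cnorm C (a *: x) <= a * Cnorm C x.
Proof.
move=> Ct a0; rewrite -ler_pdivrMl//; apply/ler_addgt0Pr => e e0.
have [b [u [v [b0 blt Cu Cv xE]]]] := Cnorm_adherent (Ct x) e0.
apply: le_trans (ltW blt); rewrite ler_pdivrMl//.
apply: (@Cnorm_le _ _ u v); rewrite ?mulr_gt0//.
by rewrite xE scalerA mulrA.
Qed.

Lemma CnormN C x : Cnorm C (- x) = Cnorm C x.
Proof.
rewrite /Cnorm; congr inf; apply/seteqP; split=> s /= [s0 [u [v [Cu Cv xE]]]];
  split=> //; exists v, u; split=> //; rewrite -opprB scalerN.
  by rewrite -xE opprK.
by rewrite xE.
Qed.

Lemma CnormC C x y : Cnorm C (x - y) = Cnorm C (y - x).
Proof. by rewrite -CnormN opprB. Qed.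

Lemma Cnorm0 C : C !=set0 -> Cnorm C 0 = 0.
Proof.
move=> [u Cu]; apply/eqP; rewrite eq_le Cnorm_ge0 andbT.
by have := @Cnorm_sub_le C u u 0 Cu Cu; rewrite scale0r mulr0; apply.
Qed.

Lemma CnormZ C x (a : R) : Cnorm_total C -> 0 <= a ->
  Cnorm C (a *: x) = a * Cnorm C x.
Proof.
move=> Ct; rewrite le_eqVlt => /predU1P[<-|a0].
  rewrite scale0r mul0r Cnorm0//.
  by have [_ [_ [u [_ [Cu _ _]]]]] := Ct x; exists u.
apply/eqP; rewrite eq_le CnormZ_le//= -ler_pdivlMl//.
rewrite -[X in Cnorm C X <= _](@scalerK _ _ a) ?gt_eqF//.
by apply: CnormZ_le; rewrite ?invr_gt0.
Qed.

Lemma norm_le_Cnorm C : Cnorm_total C -> norm_bounded C ->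
  exists2 D : R, 0 < D & forall x, `|x| <= D * Cnorm C x.
Proof.
move=> Ct [D D0 CD]; exists D => // x; rewrite -ler_pdivrMl//.
apply/ler_addgt0Pr => e e0.
have [b [u [v [b0 blt Cu Cv xE]]]] := Cnorm_adherent (Ct x) e0.
apply: le_trans (ltW blt); rewrite ler_pdivrMl// xE normrZ ger0_norm; last by lra.
have := ler_normB u v; have := CD _ Cu; have := CD _ Cv.
set Nu := `|u|; set Nv := `|v|; set Nuv := `|_ - _| => h1 h2 h3.
have h : Nuv <= 2 * D by lra.
by have := ler_wpM2l (_ : 0 <= b / 2) h => /(_ ltac:(lra)); lra.
Qed.

Lemma Cnorm_eq0 C x : Cnorm_total C -> norm_bounded C ->
  Cnorm C x = 0 -> x = 0.
Proof.
move=> Ct /(norm_le_Cnorm Ct)[D D0 CD] x0; apply/eqP; rewrite -normr_le0.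
by rewrite (le_trans (CD x))// x0 mulr0.
Qed.

(** Boundedness of [C] bounds the unit ball of [Cnorm C], so [dual_norm] is a genuine supremum and
    [x] can be normalised; a vector of norm 0 vanishes and is treated apart. *)
Lemma dot_le_dual_norm C g x : Cnorm_total C -> norm_bounded C ->
  dot g x <= dual_norm (Cnorm C) g * Cnorm C x.
Proof.
move=> Ct Cb; have [D D0 CD] := norm_le_Cnorm Ct Cb.
have := Cnorm_ge0 C x; rewrite le_eqVlt => /predU1P[x0|x0].
  by rewrite -x0 mulr0 (Cnorm_eq0 Ct Cb (esym x0)) -[X in dot g X](scale0r 0) dotZr mul0r.
rewrite -ler_pdivrMr// mulrC -dotZr; apply: ub_le_sup.
  exists ((\sum_i `|g 0 i|) * D) => _ [y /= y1 <-].
  apply: le_trans (dot_le_norm _ _) _; apply: ler_wpM2l; first exact: sumr_ge0.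
  by rewrite (le_trans (CD y))// ler_piMr// ltW.
exists ((Cnorm C x)^-1 *: x) => //=.
by rewrite CnormZ ?invr_ge0 ?Cnorm_ge0// mulVf ?gt_eqF.
Qed.

End CNormTheory.

(** * Topology and convexity of polytopes and their faces *)

Section Polytopes.
Context {R : realType} {n : nat}.
Implicit Types (C F : set 'rV[R]_n) (c x y u v : 'rV[R]_n).

Lemma continuous_lin_comb k (p : 'I_k -> 'rV[R]_n) :
  continuous (fun w : 'rV[R]_k => \sum_i w 0 i *: p i).
Proof.
apply: continuous_big; first exact: add_continuous.
move=> i _ w; have wi : v 0 i @[v --> w] --> w 0 i by exact: coord_continuous.
exact: cvgZr_tmp wi.
Qed.

Lemma continuous_dot c : continuous (dot c).
Proof.
rewrite (_ : dot c = fun x => \sum_i x 0 i * c 0 i); last first.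
  by apply/funext => x; rewrite dotE; apply: eq_bigr => i _; rewrite mulrC.
apply: continuous_big; first exact: add_continuous.
by move=> i _ w; apply: continuousM; [exact: coord_continuous|exact: cst_continuous].
Qed.

Lemma simplex_compact k :
  compact [set w : 'rV[R]_k | (forall i, 0 <= w 0 i) /\ \sum_i w 0 i = 1].
Proof.
apply: bounded_closed_compact.
  exists 1; split=> // b b1 w /= [w0 w1]; apply: le_trans (ltW b1).
  rewrite [leLHS](_ : _ = mx_norm w)// mx_normrE; apply: bigmax_le => // -[i j] _ /=.
  by rewrite ord1 ger0_norm// -w1 (bigD1 j)//= lerDl sumr_ge0.
rewrite (_ : [set _ | _] =
    \bigcap_(i in setT) [set w : 'rV[R]_k | 0 <= w 0 i] `&`
    [set w : 'rV[R]_k | \sum_i w 0 i = 1]); last first.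
  apply/seteqP; split => w [w0 w1]; split=> // i; last exact: (w0 i I).
  by move=> _; exact: w0.
apply: closedI.
  apply: closed_bigI => i _.
  apply: (@preimage_closed _ _ (fun w : 'rV[R]_k => w 0 i) [set x | 0 <= x]).
    by move=> w _; exact: coord_continuous.
  exact: closed_ge.
apply: (@preimage_closed _ _ (fun w : 'rV[R]_k => \sum_i w 0 i) [set x | x = 1]).
  move=> w _; apply: continuous_big; first exact: add_continuous.
  by move=> i _; exact: coord_continuous.
exact: closed_eq.
Qed.

(** A polytope is the continuous image of the compact simplex of weights. *)
Lemma polytope_closed C : polytope C -> closed C.
Proof.
move=> [k [p ->]]; rewrite (_ : [set _ | _] =
  [set \sum_i w 0 i *: p i | w in
   [set w : 'rV[R]_k | (forall i, 0 <= w 0 i) /\ \sum_i w 0 i = 1]]).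
  apply: compact_closed; first exact: norm_hausdorff.
  apply: continuous_compact (@simplex_compact k).
  by apply: continuous_subspaceT; exact: continuous_lin_comb.
apply/seteqP; split => [x [w [w0 w1 ->]]|_ [w [w0 w1] <-]].
  exists (\row_i w i); last by apply: eq_bigr => i _; rewrite mxE.
  split; first by move=> i; rewrite mxE.
  by rewrite -w1; apply: eq_bigr => i _; rewrite mxE.
by exists (fun i => w 0 i).
Qed.

Lemma polytope_bounded C : polytope C -> norm_bounded C.
Proof.
move=> [k [p ->]]; exists (1 + \sum_i `|p i|).
  by rewrite (lt_le_trans ltr01)// lerDl sumr_ge0.
move=> _ [w [w0 w1 ->]]; apply: le_trans (ler_norm_sum _ _ _) _.
rewrite -[leLHS]add0r lerD// ler_sum// => i _; rewrite normrZ ger0_norm//.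
by rewrite ler_piMl// -w1 (bigD1 i)//= lerDl sumr_ge0.
Qed.

Lemma polytope_segment_closed C : polytope C -> segment_closed C.
Proof.
move=> [k [p ->]] _ _ s [w [w0 w1 ->]] [z [z0 z1 ->]] /andP[s0 s1].
exists (fun i => (1 - s) * w i + s * z i); split.
- by move=> i; rewrite addr_ge0// mulr_ge0// subr_ge0.
- by rewrite big_split/= -!mulr_sumr w1 z1; ring.
- rewrite !scaler_sumr -big_split; apply: eq_bigr => i _ /=.
  by rewrite [RHS]scalerDl !scalerA.
Qed.

(** Induction on the number of terms: convexity merges two positive multiples of differences of
    points of [C] into one, as in the triangle inequality for [Cnorm]. *)
Lemma span_Cnorm_total C : segment_closed C -> C !=set0 ->
  linear_span (set_diff C) = setT -> Cnorm_total C.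
Proof.
move=> Cc [c0 Cc0] Cs x.
have : linear_span (set_diff C) x by rewrite Cs.
suff H k (w : 'I_k -> R) (p : 'I_k -> 'rV[R]_n) :
    (forall i, set_diff C (p i)) -> exists (a : R) u v,
    [/\ 0 < a, C u, C v & \sum_i w i *: p i = a *: (u - v)].
  move=> [k [w [p [Cp ->]]]]; have [a [u [v [a0 Cu Cv ->]]]] := H k w p Cp.
  exists (2 * a); split; first by rewrite mulr_gt0.
  by exists u, v; split=> //; congr (_ *: _); field.
elim: k w p => [|k IH] w p Cp.
  by exists 1, c0, c0; split=> //; rewrite big_ord0 subrr scaler0.
rewrite big_ord_recl.
have [a [u [v [a0 Cu Cv ->]]]] :=
  IH (fun i => w (lift ord0 i)) _ (fun i => Cp (lift ord0 i)).
have [u' Cu' [v' Cv' <-]] := Cp ord0.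
(* A negative weight is made positive by exchanging [u'] and [v']. *)
wlog w0 : u' v' Cu' Cv' w / 0 <= w ord0.
  move=> H; have [|/ltW w0] := leP 0 (w ord0); first exact: H.
  have := @H v' u' Cv' Cu' (fun i => - w i); rewrite oppr_ge0.
  by move=> /(_ w0); rewrite -opprB scaleNr scalerN opprK.
move: w0; rewrite le_eqVlt => /predU1P[<-|b0].
  by exists a, u, v; split=> //; rewrite scale0r add0r.
set b := w ord0 in b0 *; have ab0 : 0 < a + b by rewrite addr_gt0.
have s01 : 0 <= b / (a + b) <= 1.
  apply/andP; split; first by apply: divr_ge0; exact: ltW.
  by rewrite ler_pdivrMr// mul1r lerDr ltW.
exists (a + b); do 2!eexists; split => //.
- exact: (Cc _ _ _ Cu Cu' s01).
- exact: (Cc _ _ _ Cv Cv' s01).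
by apply/rowP => i; rewrite !mxE; field; rewrite gt_eqF.
Qed.

Lemma face_sub C F : face C F -> F `<=` C.
Proof. by move=> [c [b [_ ->]]] x []. Qed.

Lemma face_closed C F : closed C -> face C F -> closed F.
Proof.
move=> Ccl [c [b [_ ->]]]; apply: closedI => //.
apply: (@preimage_closed _ _ (dot c) [set x | x = b]); last exact: closed_eq.
by move=> x _; exact: continuous_dot.
Qed.

Lemma face_segment_closed C F : segment_closed C -> face C F -> segment_closed F.
Proof.
move=> Cc [c [b [_ ->]]] x y s [Cx xb] [Cy yb] s01; split; first exact: Cc.
by rewrite dotDr !dotZr xb yb; ring.
Qed.

Lemma affine_hull_line (A : set 'rV[R]_n) x y (s : R) : A x -> A y ->
  affine_hull A (x + s *: (y - x)).
Proof.
move=> Ax Ay; exists 2%N, (fun i => if i == ord0 then 1 - s else s),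
  (fun i => if i == ord0 then x else y); split.
- by move=> i; case: ifP.
- by rewrite !big_ord_recl big_ord0/=; ring.
- rewrite !big_ord_recl big_ord0/=.
  by apply/rowP => i; rewrite !mxE; ring.
Qed.

End Polytopes.

(** * Relative interior and relative boundary of a face *)

Section RelativeInterior.
Context {R : realType} {n : nat}.
Implicit Types (C F : set 'rV[R]_n) (x y : 'rV[R]_n).

Lemma relint_openP F x : relint F x -> exists2 e : R, 0 < e &
  forall y, `|y - x| < e -> affine_hull F y -> F y.
Proof.
move=> [Fx /nbhs_ballP[e /= e0 xe]]; exists e => // y yx; apply: xe.
by rewrite mx_norm_ball /ball_/= distrC.
Qed.

(** A small ball around [x] meets the affine hull only inside [F], so every point of [F] in that
    ball is again relatively interior. *)
Lemma relbd_away F x : closed F -> relint F x -> exists2 e : R, 0 < e &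
  forall y, relbd F y -> e <= `|y - x|.
Proof.
move=> Fcl /relint_openP[e e0 xe]; exists e => // y [Fy Ny]; rewrite leNgt.
apply/negP => yx; apply: Ny; split; first exact: Fcl.
have e' : 0 < e - `|y - x| by rewrite subr_gt0.
apply/nbhs_ballP; exists (e - `|y - x|) => // z.
rewrite mx_norm_ball /ball_/= => yz; apply: xe.
have := ler_normD (z - y) (y - x).
rewrite addrA subrK => h; apply: le_lt_trans h _.
by rewrite distrC; lra.
Qed.

(** The separation of [x] from the relative boundary in the ambient norm transfers to [Cnorm C] up
    to the factor [D]; a nonempty boundary excludes the default value of [inf]. *)
Lemma const_rho_gt0 C F x : Cnorm_total C -> norm_bounded C -> closed F ->
  relint F x -> relbd F !=set0 -> 0 < const_rho C F x.
Proof.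
move=> Ct Cb Fcl xF [y0 y0F]; have [D D0 CD] := norm_le_Cnorm Ct Cb.
have [e e0 He] := relbd_away Fcl xF.
apply: (@lt_le_trans _ _ (D^-1 * e)); first by rewrite mulr_gt0 ?invr_gt0.
apply: lb_le_inf; first by exists (Cnorm C (y0 - x)), y0.
move=> _ [y yF <-]; rewrite ler_pdivrMl//; apply: le_trans (CD _).
exact: He.
Qed.

Lemma const_rho_le C F x y : relbd F y -> const_rho C F x <= Cnorm C (y - x).
Proof.
move=> yF; apply: ge_inf; last by exists y.
by exists 0 => _ [z _ <-]; exact: Cnorm_ge0.
Qed.

(* Otherwise the last point of F on the segment from x to x - s (y - x) would be
   a relative boundary point closer to x than const_rho. *)
Lemma relint_reflect C F x y (s : R) : Cnorm_total C -> norm_bounded C ->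
  closed F -> relint F x -> F y -> 0 <= s ->
  s * Cnorm C (y - x) <= const_rho C F x -> F (x - s *: (y - x)).
Proof.
move=> Ct Cb Fcl xF Fy s0 srho; apply: contrapT => NF.
have Fx := xF.1.
pose g (tau : R) := x + tau *: (x - y).
have gs : x - s *: (y - x) = g s by rewrite /g -scalerN opprB.
rewrite gs in NF.
have g_cont : continuous g.
  move=> tau; apply: cvgD; first exact: cvg_cst.
  by apply: cvgZr_tmp; exact: cvg_id.
have g_aff tau : affine_hull F (g tau).
  rewrite /g -opprB -[y - x]opprK opprK scalerN -scaleNr.
  exact: affine_hull_line.
pose E := [set tau | 0 <= tau <= s /\ F (g tau)].
have E0 : E 0 by split; rewrite ?lexx//= /g scale0r addr0.
have Eub : ubound E s by move=> tau [/andP[]].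
have Esup : has_sup E by split; [exists 0 | exists s].
have sup0 : 0 <= sup E by apply: ub_le_sup => //; exists s.
have sups : sup E <= s by apply: ge_sup => //; exists 0.
have Fcl_sup : closure F (g (sup E)).
  move=> A /g_cont/nbhs_ballP[e /= e0 Ae].
  have [tau Etau taue] := sup_adherent e0 Esup.
  exists (g tau); split; first by case: Etau.
  apply: Ae; rewrite /ball/= ger0_norm; first lra.
  by rewrite subr_ge0; apply: ub_le_sup => //; exists s.
have Nsup : sup E != s.
  by apply/eqP => sE; apply: NF; rewrite -sE; exact: Fcl.
have sup_lt : sup E < s by rewrite lt_neqAle Nsup.
have bd : relbd F (g (sup E)).
  split=> // -[_ /g_cont/nbhs_ballP[e /= e0 Ae]].
  (* If [g (sup E)] were relatively interior, [F] would contain the points of the line just beyond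
     it; the minimum keeps the parameter within [s]. *)
  pose tau := Num.min s (sup E + e / 2).
  have taugt : sup E < tau by rewrite lt_min sup_lt/=; lra.
  have taule : tau <= sup E + e / 2 by rewrite ge_min lexx orbT.
  suff /(ub_le_sup Esup.2) : E tau by rewrite leNgt taugt.
  split; first by rewrite (le_trans sup0 (ltW taugt))/= ge_min lexx.
  apply: Ae (g_aff _); rewrite /ball/= ler0_norm; lra.
have := const_rho_le C x bd; rewrite /g addrC addKr CnormZ// CnormC => rho_le.
have N0 := Cnorm_ge0 C (y - x).
have [N00|N0'] := eqVneq (Cnorm C (y - x)) 0.
  apply: NF; rewrite /g -opprB (Cnorm_eq0 Ct Cb N00).
  by rewrite oppr0 scaler0 addr0.
have := le_trans srho rho_le; rewrite ler_pM2r ?lt_neqAle 1?eq_sym ?N0'//.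
by rewrite leNgt sup_lt.
Qed.

End RelativeInterior.

(** * Smoothness and convexity inequalities, and the constant B *)

Section Smoothness.
Context {R : realType} {n : nat}.
Context (C : set 'rV[R]_n) (f : 'rV[R]_n -> R) (L : R)
  (C_conv : segment_closed C) (C_total : Cnorm_total C)
  (C_bounded : norm_bounded C) (f_C1 : C1_around C f)
  (f_lipschitz : lipschitz_grad C f L).
Implicit Types (x y d : 'rV[R]_n) (s : R).

Lemma derive_dot x d : differentiable f x -> 'D_d f x = dot (grad f x) d.
Proof.
move=> fx; rewrite deriveE// {1}[d]row_sum_delta linear_sum dotE.
by apply: eq_bigr => i _; rewrite linearZ/= mxE -deriveE// mulrC.
Qed.

Lemma is_derive_line x d s : differentiable f (x + s *: d) ->
  is_derive s 1 (fun u : R => f (x + u *: d)) (dot (grad f (x + s *: d)) d).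
Proof.
move=> fs; have E : (fun h : R => h^-1 *: (((fun u : R => f (x + u *: d)) \o shift s)
      (h *: 1) - f (x + s *: d))) =
    (fun h : R => h^-1 *: ((f \o shift (x + s *: d)) (h *: d) - f (x + s *: d))).
  apply/funext => h; congr (_ *: (f _ - _)).
  by rewrite /= /shift/= [h *: 1]mulr1 scalerDl addrCA.
apply: DeriveDef; first by rewrite /derivable E; exact: diff_derivable.
by rewrite /derive E -derive_dot.
Qed.

Lemma line_in x y s : C x -> C y -> 0 <= s <= 1 -> C (x + s *: (y - x)).
Proof.
move=> Cx Cy s01; rewrite (_ : _ + _ = (1 - s) *: x + s *: y); first exact: C_conv.
by apply/rowP => i; rewrite !mxE; ring.
Qed.

Lemma C1_differentiable x : C x -> differentiable f x.
Proof. by case: f_C1 => U [_ CU fU _] /CU; exact: fU. Qed.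

(** The factor 4 is 2 times 2: [y - x] has C-norm at most 2, and the displacement [s *: (y - x)] at
    most [2 * s]. *)
Lemma grad_line_le x y s : 0 <= L -> C x -> C y -> 0 <= s <= 1 ->
  `|dot (grad f (x + s *: (y - x)) - grad f x) (y - x)| <= 4 * L * s.
Proof.
move=> L0 Cx Cy s01; have Cz := line_in Cx Cy s01; have s0 : 0 <= s by lra.
have N1 : Cnorm C (y - x) <= 2.
  by rewrite -[y - x]scale1r -[leRHS]mulr1; exact: Cnorm_sub_le.
have N2 : Cnorm C (s *: (y - x)) <= 2 * s by exact: Cnorm_sub_le.
have bound g z : dual_norm (Cnorm C) g <= L * Cnorm C z ->
    Cnorm C z <= 2 * s -> dot g (y - x) <= 4 * L * s.
  move=> gz zs; apply: le_trans (dot_le_dual_norm _ _ C_total C_bounded) _.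
  rewrite (_ : 4 * L * s = L * (2 * s) * 2); last by ring.
  apply: (@le_trans _ _ (L * (2 * s) * Cnorm C (y - x))).
    apply: ler_wpM2r; first exact: Cnorm_ge0.
    by apply: le_trans gz _; apply: ler_wpM2l.
  by apply: ler_wpM2l => //; rewrite !mulr_ge0.
rewrite ler_norml; apply/andP; split.
  rewrite lerNl dotBl opprB -dotBl.
  apply: bound (f_lipschitz Cx Cz) _.
  by rewrite CnormC addrC addKr.
apply: bound (f_lipschitz Cz Cx) _.
by rewrite addrC addKr.
Qed.

(** The quadratic correction [k * s ^+ 2] lets the mean value theorem replace integration of the
    gradient: [k = 2 * L] yields the sharp constant in [smooth_upper], while [k = 0] gives the
    cruder [smooth_lower]. *)
Lemma line_MVT (k : R) x y s : C x -> C y -> 0 < s <= 1 ->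
  exists2 c, 0 < c < s & f (x + s *: (y - x)) - k * s ^+ 2 - f x =
    (dot (grad f (x + c *: (y - x))) (y - x) - 2 * k * c) * s.
Proof.
move=> Cx Cy /andP[s0 s1].
have fl c : 0 <= c <= s -> is_derive c 1 (fun u => f (x + u *: (y - x)) - k * u ^+ 2)
    (dot (grad f (x + c *: (y - x))) (y - x) - 2 * k * c).
  move=> cs; have c01 : 0 <= c <= 1 by lra.
  have H := is_derive_line (C1_differentiable (line_in Cx Cy c01)).
  apply: is_derive_eq; rewrite /GRing.scale/=; ring.
have [||c] := MVT s0 (f := fun u => f (x + u *: (y - x)) - k * u ^+ 2)
  (df := fun c => dot (grad f (x + c *: (y - x))) (y - x) - 2 * k * c).
- by move=> c; rewrite in_itv/= => /andP[c0 cs]; apply: fl; lra.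
- apply: derivable_within_continuous => c; rewrite in_itv/= => cs.
  by have [] := fl c cs.
rewrite in_itv/= scale0r addr0 expr0n mulr0 !subr0 => cs E.
by exists c.
Qed.

Lemma smooth_upper x y s : 0 <= L -> C x -> C y -> 0 <= s <= 1 ->
  f (x + s *: (y - x)) <= f x + s * dot (grad f x) (y - x) + 2 * L * s ^+ 2.
Proof.
move=> L0 Cx Cy /andP[]; rewrite le_eqVlt => /predU1P[<- _|s0 s1].
  by rewrite scale0r mul0r expr0n mulr0 !addr0.
have [|c /andP[c0 cs] E] := @line_MVT (2 * L) x y s Cx Cy; first by rewrite s0.
have := @grad_line_le x y c L0 Cx Cy ltac:(lra).
rewrite dotBl ler_norml => /andP[_]; move: E.
set a := dot _ _; set b := dot _ _ => E ab.
have : (a - 2 * (2 * L) * c) * s <= b * s by rewrite ler_pM2r//; lra.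
by rewrite -E; set fs := f (x + _); lra.
Qed.

Lemma smooth_lower x y s : 0 <= L -> C x -> C y -> 0 <= s <= 1 ->
  f x + s * dot (grad f x) (y - x) - 4 * L * s ^+ 2 <= f (x + s *: (y - x)).
Proof.
move=> L0 Cx Cy /andP[]; rewrite le_eqVlt => /predU1P[<- _|s0 s1].
  by rewrite scale0r mul0r expr0n mulr0 !subr0 !addr0.
have [|c /andP[c0 cs] E] := @line_MVT 0 x y s Cx Cy; first by rewrite s0.
have := @grad_line_le x y c L0 Cx Cy ltac:(lra).
rewrite dotBl ler_norml => /andP[+ _]; move: E.
set a := dot _ _; set b := dot _ _ => E ab.
have Lc : L * c <= L * s by apply: ler_wpM2l => //; exact: ltW.
have : (b - 4 * L * s) * s <= a * s by rewrite ler_pM2r//; lra.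
by move: E; set fs := f (x + _); lra.
Qed.

(** Were the tangent inequality violated by [delta], convexity and [smooth_lower] on a short segment
    would give [delta <= 4 * L * s], whereas the choice of [s] makes the right side at most
    [delta / 2]. *)
Lemma convex_grad_le x y : 0 < L -> convex_function C f -> C x -> C y ->
  dot (grad f x) (y - x) <= f y - f x.
Proof.
move=> L0 fc Cx Cy; rewrite leNgt; apply/negP => lt.
pose delta := dot (grad f x) (y - x) - (f y - f x).
have d0 : 0 < delta by rewrite subr_gt0.
pose s := Num.min 1 (delta / (8 * L)).
have L8 : 0 < 8 * L by rewrite mulr_gt0.
have s0 : 0 < s by rewrite lt_min ltr01 divr_gt0.
have s1 : s <= 1 by rewrite ge_min lexx.
have sd : s * (8 * L) <= delta by rewrite -ler_pdivlMr// ge_min lexx orbT.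
have s01 : 0 <= s <= 1 by rewrite ltW.
have low := smooth_lower (ltW L0) Cx Cy s01.
(* The weight [s] falls on the first point, hence [y] before [x]. *)
have := fc (Itv01 (ltW s0) s1) y x (mem_set Cy) (mem_set Cx).
rewrite /conv/= /conv/=.
rewrite (_ : s *: y + _ = x + s *: (y - x)); last first.
  by apply/rowP => i; rewrite !mxE /unstable.onem; ring.
rewrite /unstable.onem /GRing.scale/= => up; move: low up d0 sd; rewrite /delta.
set a := dot _ _; set fs := f (x + _) => low up d0 sd.
have : s * (a - 4 * L * s) <= s * (f y - f x) by lra.
by rewrite ler_pM2l//; lra.
Qed.

(** The Lipschitz condition compares every gradient with the one at [x0], at C-distance at most 2.
    This makes the supremum in [constB] one over a bounded set. *)
Lemma dot_grad_le : 0 <= L -> C !=set0 -> exists K : R, forall y z, C y ->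
  `|dot (grad f y) z| <= K * Cnorm C z.
Proof.
move=> L0 [x0 Cx0]; exists (dual_norm (Cnorm C) (grad f x0) + 2 * L) => y z Cy.
have H w : dot (grad f y) w <= (dual_norm (Cnorm C) (grad f x0) + 2 * L) * Cnorm C w.
  rewrite -[dot _ w](subrK (dot (grad f x0) w)) -dotBl addrC mulrDl.
  apply: lerD; first exact: dot_le_dual_norm.
  apply: le_trans (dot_le_dual_norm _ _ C_total C_bounded) _.
  apply: ler_wpM2r; first exact: Cnorm_ge0.
  apply: le_trans (f_lipschitz Cy Cx0) _; rewrite mulrC ler_wpM2r//.
  have := @Cnorm_sub_le _ _ C y x0 1 Cy Cx0 ler01.
  by rewrite scale1r mulr1.
by rewrite ler_norml H andbT lerNl -dotNr -(CnormN C z).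
Qed.

(** Multiplying out the quotient extends the bound to points of [F], where [x - bar x = 0]; off [F]
    the norm is positive because [bar x] lies in [F]. *)
Lemma constB_spec F bar : 0 <= L -> C !=set0 -> nearest_selection C F bar ->
  face C F ->
  0 <= constB C F f bar /\ forall x y, C x -> C y ->
    `|dot (grad f y) (x - bar x)| <= constB C F f bar * Cnorm C (x - bar x).
Proof.
move=> L0 [x0 Cx0] Hbar FC.
have near0 x : F x -> C x -> x - bar x = 0.
  move=> Fx Cx; have [_ /(_ x Fx)] := Hbar x Cx.
  rewrite subrr (Cnorm0 (ex_intro _ x0 Cx0)) => N0.
  by apply: (Cnorm_eq0 C_total C_bounded); apply/eqP; rewrite eq_le N0 Cnorm_ge0.
rewrite /constB; case: asboolP => [FE|FE].
  split=> // x y Cx Cy; rewrite near0 ?FE//.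
  by rewrite -[X in dot _ X](scale0r 0) dotZr !mul0r normr0.
set A := [set _ | _ in _ & _ in _].
have A0 : lbound A 0.
  by move=> _ [y Cy [x _ <-]]; rewrite divr_ge0// Cnorm_ge0.
have Aub : has_ubound A.
  have [K HK] := dot_grad_le L0 (ex_intro _ x0 Cx0).
  exists K => _ [y Cy [x [Cx NFx] <-]]; rewrite ler_pdivrMr ?HK//.
  rewrite lt_neqAle Cnorm_ge0 andbT eq_sym; apply/eqP => /(Cnorm_eq0 C_total C_bounded).
  by move/subr0_eq => xE; apply: NFx; rewrite xE; exact: (Hbar x Cx).1.
have supA0 : 0 <= sup A.
  have [->|/set0P[a Aa]] := eqVneq A set0; first by rewrite sup0.
  by apply: le_trans (A0 _ Aa) _; exact: ub_le_sup.
split=> // x y Cx Cy; have [Fx|NFx] := pselect (F x).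
  rewrite near0// -[X in dot _ X](scale0r 0) dotZr mul0r normr0.
  by rewrite mulr_ge0// Cnorm_ge0.
have N0 : 0 < Cnorm C (x - bar x).
  rewrite lt_neqAle Cnorm_ge0 andbT eq_sym; apply/eqP => /(Cnorm_eq0 C_total C_bounded).
  by move/subr0_eq => xE; apply: NFx; rewrite xE; exact: (Hbar x Cx).1.
rewrite -ler_pdivrMr//; apply: ub_le_sup => //.
by exists y => //; exists x.
Qed.

End Smoothness.

(** * Step-size estimates and the abstract recursion *)

Section StepSize.
Context {R : realType}.
Context (l : nat) (l_ge2 : (2 <= l)%N).
Local Notation eta := (@stepsize R l).

Lemma bernoulli_le (u : R) k : 0 <= u <= 1 -> 1 - k%:R * u <= (1 - u) ^+ k.
Proof.
move=> /andP[u0 u1]; elim: k => [|k IH]; first by rewrite expr0; lra.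
have ku : 0 <= k%:R * u * u by rewrite !mulr_ge0 ?ler0n.
have := ler_wpM2r (_ : 0 <= 1 - u) IH => /(_ ltac:(lra)).
by rewrite -exprSr -natr1; lra.
Qed.

Lemma stepsize_gt0 t : 0 < eta t.
Proof. by rewrite divr_gt0// ltr0n ?addn_gt0 (leq_trans _ l_ge2)// orbT. Qed.

Lemma stepsize_le1 t : eta t <= 1.
Proof.
have tl : (0 < t + l)%N by rewrite addn_gt0 (leq_trans _ l_ge2)// orbT.
by rewrite ler_pdivrMr ?ltr0n// mul1r ler_nat leq_addl.
Qed.

Lemma stepsize_itv t : 0 <= eta t <= 1.
Proof. by rewrite stepsize_le1// (ltW (stepsize_gt0 _)). Qed.

Lemma stepsize_le s t : (s <= t)%N -> eta t <= eta s.
Proof.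
move=> st; rewrite ler_wpM2l// lef_pV2 ?posrE ?ltr0n ?addn_gt0
  ?(leq_trans _ l_ge2) ?orbT//.
by rewrite ler_nat leq_add2r.
Qed.

(** The ratio is [q = 1 - 1 / (t + 1 + l)], and [1 - eta t.+1] is [1 - l / (t + 1 + l)], so
    Bernoulli compares it with [q ^+ l]. *)
Lemma stepsize_ratio t : exists q : R,
  [/\ 0 < q <= 1, eta t.+1 = q * eta t & 1 - eta t.+1 <= q ^+ l].
Proof.
have tl : (0 : R) < (t + l)%:R by rewrite ltr0n addn_gt0 (leq_trans _ l_ge2)// orbT.
have tl1 : (0 : R) < (t.+1 + l)%:R by rewrite ltr0n.
have tlE : (t.+1 + l)%:R = (t + l)%:R + 1 :> R by rewrite addSn natr1.
exists (1 - (t.+1 + l)%:R^-1); split.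
- rewrite subr_gt0 invf_lt1// gerBl invr_ge0 ltW// andbT.
  by rewrite ltr1n addSn ltnS addn_gt0 (leq_trans _ l_ge2) ?orbT.
- rewrite /stepsize tlE; move: tl; set a := (t + l)%:R => a0.
  by field; apply/andP; split; lra.
- apply: bernoulli_le; rewrite invr_ge0 ltW//= invf_le1// ler1n.
  by rewrite addSn.
Qed.

Lemma stepsize_contraction t : (1 - eta t.+1) * eta t ^+ l <= eta t.+1 ^+ l.
Proof.
have [q [_ etaS ql]] := stepsize_ratio t; rewrite [in leRHS]etaS (exprMn _ q).
by apply: ler_wpM2r => //; rewrite exprn_ge0// ltW// stepsize_gt0.
Qed.

Lemma stepsize_contraction_powR t (p : R) : 0 <= p <= l%:R ->
  (1 - eta t.+1) * eta t `^ p <= eta t.+1 `^ p.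
Proof.
move=> /andP[p0 pl]; have [q [/andP[q0 q1] etaS ql]] := stepsize_ratio t.
rewrite [in leRHS]etaS powRM ?(ltW q0) ?(ltW (stepsize_gt0 t))//.
apply: ler_wpM2r; first exact: powR_ge0.
by apply: le_trans ql _; rewrite -powR_mulrn ?(ltW q0)// ger_powR// q0.
Qed.

(** The factor has index [t] instead of [t.+1]: monotonicity gives [1 - eta t <= 1 - eta t.+1], and
    [2 <= l] weakens [q ^+ l] to [q ^+ 2]. *)
Lemma stepsize_contraction_sqr t : (1 - eta t) * eta t ^+ 2 <= eta t.+1 ^+ 2.
Proof.
have [q [/andP[q0 q1] etaS ql]] := stepsize_ratio t; rewrite etaS (exprMn _ q).
apply: ler_wpM2r; first by rewrite exprn_ge0// ltW// stepsize_gt0.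
apply: (@le_trans _ _ (q ^+ l)).
  by apply: le_trans ql; rewrite lerB// stepsize_le.
by rewrite ler_wiXn2l// (ltW q0).
Qed.

(** A contraction step shrinks both arguments of the maximum at least as slowly as [h]; any other
    step lands directly below the second argument at [t.+1]. The bound lags by one index, so [0 < S]
    is what starts it with ratio 1. *)
Lemma stepsize_recursion (h : nat -> R) (S : nat) (p K : R) :
  (0 < S)%N -> 0 <= h S -> 0 <= K -> 0 <= p <= l%:R ->
  (forall t, (S <= t)%N ->
     h t.+1 <= (1 - eta t) * h t \/ h t.+1 <= eta t `^ p * K) ->
  forall t, (S <= t)%N ->
    h t <= Num.max (h S * (eta t.-1 / eta S.-1) ^+ l) (eta t.-1 `^ p * K).
Proof.
move=> S0 hS0 K0 pl step t St; rewrite -(subnK St).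
elim: (t - S)%N => {t St} [|k IH].
  by rewrite add0n divff ?gt_eqF ?stepsize_gt0// expr1n mulr1 le_max lexx.
rewrite addSn/=; have Sk : (S <= k + S)%N by rewrite leq_addl.
have [hk|hk] := step _ Sk; last by rewrite le_max hk orbT.
apply: le_trans hk _.
have kS : (k + S)%N = (k + S).-1.+1 by rewrite prednK// addn_gt0 S0 orbT.
move: IH; rewrite kS/=; set j := (k + S).-1 => IH.
have e0 : 0 <= 1 - eta j.+1 by rewrite subr_ge0 stepsize_le1.
apply: le_trans (ler_wpM2l e0 IH) _; rewrite maxr_pMr//.
apply: le_max2.
  rewrite mulrCA ler_wpM2l// (expr_div_n (eta j)) (expr_div_n (eta j.+1)).
  rewrite mulrA ler_wpM2r//.
    by rewrite invr_ge0 exprn_ge0// ltW// stepsize_gt0.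
  exact: stepsize_contraction.
by rewrite mulrA ler_wpM2r// stepsize_contraction_powR.
Qed.

End StepSize.

(** * One iteration in terms of real numbers, and the asymptotic rate *)

Lemma one_step_alternative {R : realType}
    (theta L mu rho B M eta etaQ h h' gap dist D : R) :
  let m := rho / (2 `^ (2 - theta) * mu) in
  let p := 1 / (1 - theta) in
  0 < theta -> theta <= 1 / 2 -> 0 < L -> 0 < mu -> 0 < rho -> 0 <= B ->
  m / etaQ * (4 * B) `^ (1 - theta) <= M -> 4 * L <= M ->
  0 < eta -> eta <= 1 -> eta <= etaQ ->
  0 <= h -> h <= gap -> h' <= h - eta * gap + 2 * L * eta ^+ 2 ->
  dist <= 2 * (eta / etaQ) ^+ 2 -> D <= 2 * mu * h `^ theta ->
  (forall s, 0 <= s -> s * D <= rho -> h + s * (h - B * dist) <= gap) ->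
  h' <= (1 - eta) * h \/ h' <= eta `^ p * ((M / m) `^ p + M / 2).
Proof.
move=> m p th0 th1 L0 mu0 rho0 B0 MB ML e0 e1 eQ h0 hgap hdesc distle Dle growth.
have m0 : 0 < m by rewrite divr_gt0// mulr_gt0// powR_gt0.
have M0 : 0 < M by apply: lt_le_trans ML; rewrite mulr_gt0.
have t1 : 0 < 1 - theta by lra.
have pE : (1 - theta) * p = 1 by rewrite /p; field; lra.
have p0 : 0 < p by rewrite divr_gt0.
have p2 : p <= 2 by rewrite /p ler_pdivrMr//; lra.
have mE : m = rho / (2 `^ (2 - theta) * mu) by [].
clearbody m p.
have [small|large] := leP (m * h `^ (1 - theta)) (M * eta).
  right; have hle : h <= (M / m) `^ p * eta `^ p.
    have Mm0 : 0 <= M / m by rewrite ltW// divr_gt0.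
    rewrite -powRM ?(ltW e0)// -[leLHS]powRr1// -pE powRrM.
    apply: ge0_ler_powR; first exact: ltW.
    - by rewrite nnegrE powR_ge0.
    - by rewrite nnegrE mulr_ge0// ltW.
    by rewrite mulrAC ler_pdivlMr// mulrC.
  have e2 : eta ^+ 2 <= eta `^ p by rewrite -powR_mulrn ?(ltW e0)// ger_powR// e0.
  have h1 : eta * h <= eta * gap by rewrite ler_pM2l.
  have h2 : 0 <= eta * h by rewrite mulr_ge0// ltW.
  have h3 : L * eta ^+ 2 <= M / 4 * eta ^+ 2.
    by apply: ler_wpM2r; [rewrite exprn_ge0// ltW|lra].
  have h4 : M / 2 * eta ^+ 2 <= M / 2 * eta `^ p by rewrite ler_wpM2l//; lra.
  by move: hle h4; rewrite [_ * (_ + _)]mulrC mulrDl; lra.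
left; have hp0 : 0 < h.
  rewrite lt_neqAle h0 andbT; apply/eqP => hE; move: large.
  by rewrite -hE powR0 ?gt_eqF// mulr0 ltNge mulr_ge0 ?(ltW M0) ?(ltW e0).
have eQ0 : 0 < etaQ by apply: lt_le_trans eQ.
pose r := eta / etaQ.
have rE : r = eta / etaQ by [].
have r0 : 0 < r by rewrite divr_gt0.
have r1 : r <= 1 by rewrite ler_pdivrMr// mul1r.
clearbody r.
(* Otherwise [m * h]^ (1 - theta)[would be at most]M * eta[by the first term of]M[: as]theta <= 1 /
   2[and]r <= 1[, the power]r [^ (2 * (1 - theta))] is at most [r]. *)
have hB : 4 * B * r ^+ 2 < h.
  rewrite ltNge; apply/negP => hle.
  have : h `^ (1 - theta) <= r * (4 * B) `^ (1 - theta).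
    apply: (@le_trans _ _ ((4 * B * r ^+ 2) `^ (1 - theta))).
      apply: ge0_ler_powR => //; first exact: ltW.
      by rewrite nnegrE !mulr_ge0// ltW.
    rewrite powRM ?mulr_ge0 ?exprn_ge0 ?(ltW r0)// mulrC ler_wpM2r ?powR_ge0//.
    rewrite -powR_mulrn ?(ltW r0)// -powRrM -[leRHS]powRr1 ?(ltW r0)//.
    by apply: ger_powR; rewrite ?r0//; lra.
  rewrite -(ler_pM2l m0) => hle2.
  have := ler_wpM2r (ltW e0) MB.
  rewrite (_ : m / etaQ * _ * _ = m * (r * (4 * B) `^ (1 - theta))); last first.
    by rewrite rE; field; rewrite gt_eqF.
  by move=> hle3; have := lt_le_trans large (le_trans hle2 hle3); rewrite ltxx.
have Bdist : B * dist <= h / 2.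
  have := ler_wpM2l B0 distle; rewrite -rE; lra.
have ht0 : 0 < h `^ theta by rewrite powR_gt0.
(* The largest [s] for which the bound on [D] guarantees [s * D <= rho]. *)
pose s := rho / (2 * mu * h `^ theta).
have den0 : 0 < 2 * mu * h `^ theta by rewrite !mulr_gt0.
have s0 : 0 < s by rewrite divr_gt0.
have sD : s * D <= rho.
  have := ler_wpM2l (ltW s0) Dle; rewrite {2}/s divfK ?gt_eqF//.
have := growth s (ltW s0) sD.
have sh : s * h = rho / (2 * mu) * h `^ (1 - theta).
  have hE : h = h `^ (1 - theta) * h `^ theta.
    by rewrite -powRD ?(gt_eqF hp0) ?implybT// subrK powRr1.
  rewrite {1}hE /s; field; rewrite ?gt_eqF//.
have mle : m <= rho / (2 * mu).
  rewrite mE ler_pM2l// lef_pV2 ?posrE ?mulr_gt0 ?powR_gt0// ler_pM2r//.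
  by apply: le1r_powR => //; lra.
have h1 := ler_wpM2r (powR_ge0 h (1 - theta)) mle.
have h2 := ler_wpM2r (ltW e0) ML.
have h3 : s * (h - B * dist) >= s * (h / 2) by rewrite ler_pM2l//; lra.
move=> hg; have : eta * (h + 2 * L * eta) <= eta * gap by rewrite ler_pM2l//; lra.
by lra.
Qed.

(** With [e = eta_{t-1} <= 1] and [p <= l], [e ^+ l <= e]^ p[, so both arguments are at most]k * e
    [^ p]; then [e <= l / t] for [t >= 1]. *)
Lemma max_stepsize_bigO (R : realType) (l : nat) (a b K p : R) :
  (2 <= l)%N -> 0 <= a -> 0 < b -> 0 <= K -> 0 <= p <= l%:R ->
  ((fun t => Num.max (a * (stepsize l t.-1 / b) ^+ l)
     (stepsize l t.-1 `^ p * K)) : nat -> R^o)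
  =O_\oo (fun t : nat => t%:R `^ (- p) : R^o).
Proof.
move=> l2 a0 b0 K0 /andP[p0 pl].
pose k := Num.max (a / b ^+ l) K.
have k0 : 0 <= k by rewrite le_max K0 orbT.
(* The summand 1 makes the constant strictly positive even when [k = 0]. *)
apply/eqO_exP; exists (k * l%:R `^ p + 1).
  by rewrite ltr_wpDl// mulr_ge0// powR_ge0.
exists 1%N => // t /= t1; have t0 : (0 : R) < t%:R by rewrite ltr0n.
have := @stepsize_gt0 R l l2 t.-1; have := @stepsize_le1 R l l2 t.-1.
have etat : stepsize l t.-1 * t%:R <= l%:R :> R.
  rewrite /stepsize mulrAC ler_pdivrMr ?ltr0n ?addn_gt0 ?(ltnW l2) ?orbT//.
  rewrite ler_wpM2l// ler_nat -(prednK t1)/= addnC.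
  by rewrite -[leqLHS]add1n leq_add2r ltnW.
move: etat; set e : R := stepsize l t.-1 => etat e1 e0.
have ep : e `^ p <= l%:R `^ p * t%:R `^ (- p).
  rewrite powRN ler_pdivlMr ?powR_gt0// -powRM ?(ltW e0) ?(ltW t0)//.
  by apply: ge0_ler_powR; rewrite ?nnegrE// mulr_ge0 ?ltW.
have el : e ^+ l <= e `^ p by rewrite -powR_mulrn ?(ltW e0)// ger_powR// e0.
rewrite [`|t%:R `^ _|]ger0_norm ?powR_ge0// ger0_norm; last first.
  by rewrite le_max [X in _ || X]mulr_ge0 ?powR_ge0 ?orbT.
apply: (@le_trans _ _ (k * e `^ p)).
  rewrite ge_max; apply/andP; split.
    rewrite (expr_div_n e b) mulrCA [leLHS]mulrC.
    apply: ler_pM => //; rewrite ?divr_ge0 ?exprn_ge0 ?(ltW e0) ?(ltW b0)//.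
    by rewrite le_max lexx.
  by rewrite mulrC ler_wpM2r ?powR_ge0// le_max lexx orbT.
apply: (@le_trans _ _ (k * (l%:R `^ p * t%:R `^ (- p)))); first exact: ler_wpM2l.
by rewrite mulrA ler_wpM2r ?powR_ge0// lerDl.
Qed.

Lemma minval_argmin (R : realType) (T : Type) (A : set T) (g : T -> R) z :
  argmin A g z -> minval A g = g z.
Proof.
move=> [Az zmin]; apply/eqP; rewrite eq_le; apply/andP; split.
  by apply: ge_inf; [exists (g z) => _ [y /zmin ? <-]|exists z].
by apply: lb_le_inf => [|_ [y /zmin ? <-]//]; exists (g z), z.
Qed.

(** * Frank-Wolfe iterates and their offset from the face *)

Section FrankWolfeStep.
Context {R : realType} {n : nat}.
Context (C Cs : set 'rV[R]_n) (f : 'rV[R]_n -> R) (xs : 'rV[R]_n)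
  (l Q : nat) (x v : nat -> 'rV[R]_n).
Local Notation eta := (@stepsize R l).
Context (l_ge2 : (2 <= l)%N) (C_conv : segment_closed C)
  (x_fw : frank_wolfe C f eta x v).

Lemma fw_vertex t : C (v t).
Proof. by have [_ /(_ t)[[]]] := x_fw. Qed.

Lemma fw_iterate t : C (x t).
Proof.
have [Cx0 xS] := x_fw; elim: t => // t IH; rewrite (xS t).2.
by apply: line_in => //; [exact: fw_vertex|exact: stepsize_itv].
Qed.

Lemma fw_vertex_min t w : C w ->
  dot (grad f (x t)) (v t) <= dot (grad f (x t)) w.
Proof.
have [_ /(_ t)[[_ vmin] _]] := x_fw; move=> /vmin.
by rewrite !dotBr lerBlDr subrK.
Qed.

(** Once the vertices lie in [Cs], a step averages the [Cs]-component with [v t] inside [Cs] and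
    multiplies the offset by [1 - eta t]. The start is [x Q = xs + 1 *: (x Q - xs)], and
    [stepsize_contraction_sqr] telescopes the factors. *)
Lemma fw_face_offset : segment_closed Cs -> Cs xs ->
  (forall t, (Q <= t)%N -> Cs (v t)) ->
  forall t, (Q <= t)%N -> exists2 z, Cs z &
    exists2 p : R, 0 <= p <= (eta t / eta Q) ^+ 2 & x t - z = p *: (x Q - xs).
Proof.
move=> Fc Fxs vF t Qt; rewrite -(subnK Qt); elim: (t - Q)%N => {t Qt} [|k [z Fz [p]]].
  exists xs => //; exists 1; last by rewrite scale1r.
  have eQ : eta Q != 0 by rewrite gt_eqF// stepsize_gt0.
  by rewrite add0n divff// expr1n ler01 lexx.
have Qk : (Q <= k + Q)%N by rewrite leq_addl.
rewrite addSn; set t := (k + Q)%N in Qk * => /andP[p0 pr] xz.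
have e01 := stepsize_itv (R := R) l_ge2 t; have [e0 e1] := andP e01.
exists ((1 - eta t) *: z + eta t *: v t); first exact: Fc (vF _ Qk) e01.
exists ((1 - eta t) * p); last first.
  rewrite -(scalerA (1 - eta t) p) -xz; have [_ /(_ t)[_ ->]] := x_fw.
  by apply/rowP => i; rewrite !mxE; ring.
rewrite mulr_ge0 ?subr_ge0//=; apply: le_trans (ler_wpM2l _ pr) _.
  by rewrite subr_ge0.
rewrite (expr_div_n (eta t)) (expr_div_n (eta t.+1)) mulrA.
apply: ler_wpM2r; first by rewrite invr_ge0 exprn_ge0// ltW// stepsize_gt0.
exact: stepsize_contraction_sqr.
Qed.

End FrankWolfeStep.

(** * Assembly of the convergence bound *)

Theorem corollary5p5 (R : realType) (n : nat)
  (C Cs : set 'rV[R]_n) (f : 'rV[R]_n -> R) (xs : 'rV[R]_n)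
  (bar : 'rV[R]_n -> 'rV[R]_n) (L mu theta : R) (l Q : nat)
  (x v : nat -> 'rV[R]_n) (B rho m M : R) (S : nat)
  (C_polytope : polytope C)
  (C_span : linear_span (set_diff C) = setT)
  (f_convex : convex_function C f)
  (f_C1 : C1_around C f)
  (xs_unique : argmin C f = [set xs])
  (Cs_face : face C Cs)
  (xs_relint : relint Cs xs)
  (L_gt0 : 0 < L)
  (mu_gt0 : 0 < mu)
  (theta_gt0 : 0 < theta)
  (theta_le : theta <= 1 / 2)
  (f_lipschitz : lipschitz_grad C f L)
  (f_holder : holder_error_bound C f (Cnorm C) mu theta)
  (l_ge2 : (2 <= l)%N)
  (x_fw : frank_wolfe C f (stepsize l) x v)
  (Q_identifies : forall t, (Q <= t)%N ->
     argmin C (fun y => dot (grad f (x t)) y) `<=` Cs)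
  (bar_nearest : nearest_selection C Cs bar)
  (Cs_relbd : relbd Cs !=set0)
  (B_def : B = constB C Cs f bar)
  (rho_def : rho = const_rho C Cs xs)
  (m_def : m = rho / (2 `^ (2 - theta) * mu))
  (M_def : M = Num.max (m / stepsize l Q * (4 * B) `^ (1 - theta))
                 (Num.max (2 * ((2 * L + B) / stepsize l Q)) (4 * L)))
  (S_def : S%:Z = Num.max 1
     (Num.max
        (Num.ceil (2 `^ (1 / theta) * l%:R * M / m `^ (1 / theta) - l%:R))
        Q%:Z)) :
  let bound (t : nat) : R :=
    Num.max
      (subopt C f x S * (stepsize l t.-1 / stepsize l S.-1) ^+ l)
      (stepsize l t.-1 `^ Num.min l%:R (Num.min (1 / (1 - theta)) 2)
         * ((M / m) `^ (1 / (1 - theta)) + M / 2)) in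
  (forall t, (S <= t)%N -> subopt C f x t <= bound t) /\
  (bound : nat -> R^o) =O_\oo
    (fun t : nat => t%:R `^ (- (1 / (1 - theta))) : R^o).

Proof.
have [Cxs xs_min] : argmin C f xs by rewrite xs_unique.
have Cc := polytope_segment_closed C_polytope.
have Ccl := polytope_closed C_polytope.
have Cb := polytope_bounded C_polytope.
have Ct := span_Cnorm_total Cc (ex_intro _ xs Cxs) C_span.
have Fcl := face_closed Ccl Cs_face.
have Fc := face_segment_closed Cc Cs_face.
have Fxs : Cs xs by case: xs_relint.
have rho0 : 0 < rho by rewrite rho_def; exact: const_rho_gt0.
have [B0 HB] := constB_spec Ct Cb f_lipschitz (ltW L_gt0)
  (ex_intro _ xs Cxs) bar_nearest Cs_face.
rewrite -B_def in B0 HB.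
have fmin : minval C f = f xs by apply: minval_argmin.
have holder y : C y -> Cnorm C (y - xs) <= mu * (f y - f xs) `^ theta.
  move=> Cy; rewrite -fmin; apply: le_trans (f_holder y Cy).
  rewrite (minval_argmin (z := xs)) ?lexx//.
  by rewrite xs_unique; split=> // _ ->.
have Cx := fw_iterate l_ge2 Cc x_fw.
have Cv := fw_vertex x_fw.
have vmin := fw_vertex_min x_fw.
have Fv t : (Q <= t)%N -> Cs (v t).
  by move=> /Q_identifies; apply; split=> // w; exact: vmin.
(* [1 <= S] makes [S.-1] a true predecessor; [Q <= S] puts every step from [S] on in the range where
   the vertices lie in [Cs]. *)
have [S1 QS] : (0 < S)%N /\ (Q <= S)%N.
  have : (1 <= S%:Z) && (Q%:Z <= S%:Z) by rewrite S_def !le_max !lexx !orbT.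
  by move=> /andP[].
have th1 : 0 < 1 - theta by lra.
pose p := 1 / (1 - theta).
have p0 : 0 <= p by rewrite divr_ge0// ltW.
have p2 : p <= 2 by rewrite /p ler_pdivrMr//; lra.
have l2 : (2 : R) <= l%:R by rewrite ler_nat.
have pl : 0 <= p <= l%:R by rewrite p0 (le_trans p2).
(* From [theta <= 1 / 2] follows [p <= 2 <= l], so the exponent in [bound] is exactly the claimed
   rate. *)
have pmin : Num.min l%:R (Num.min p 2) = p.
  by rewrite (min_idPl p2); apply/min_idPr; case/andP: pl.
have MB : m / stepsize l Q * (4 * B) `^ (1 - theta) <= M.
  by rewrite M_def le_max lexx.
have ML : 4 * L <= M by rewrite M_def !le_max lexx !orbT.
have K0 : 0 <= (M / m) `^ p + M / 2.
  rewrite addr_ge0 ?powR_ge0// divr_ge0//; apply: le_trans ML.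
  by rewrite mulr_ge0// ltW.
have hge0 t : 0 <= subopt C f x t.
  by rewrite /subopt fmin subr_ge0; exact: xs_min.
have step t : (Q <= t)%N ->
    subopt C f x t.+1 <= (1 - stepsize l t) * subopt C f x t \/
    subopt C f x t.+1 <= stepsize l t `^ p * ((M / m) `^ p + M / 2).
  move=> Qt; rewrite m_def; set g := grad f (x t); set xb := bar (x t).
  have Fxb : Cs xb := (bar_nearest _ (Cx t)).1.
  have xb_le := (bar_nearest _ (Cx t)).2.
  have e01 := stepsize_itv (R := R) l_ge2 t; have [e0 e1] := andP e01.
  have gxs : subopt C f x t <= dot g (x t - xs).
    have := convex_grad_le Cc Ct Cb f_C1 f_lipschitz L_gt0 f_convex (Cx t) Cxs.
    by rewrite /subopt fmin -[xs - _]opprB dotNr -/g; lra.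
  apply: (@one_step_alternative R theta L mu rho B M (stepsize l t)
    (stepsize l Q) _ _ (dot g (x t - v t)) (Cnorm C (x t - xb))
    (Cnorm C (xb - xs))) => //.
  - by rewrite -m_def.
  - exact: stepsize_gt0.
  - exact: stepsize_le.
  - apply: le_trans gxs _; rewrite !dotBr lerB//; exact: vmin.
  - have := smooth_upper Cc Ct Cb f_C1 f_lipschitz (ltW L_gt0) (Cx t) (Cv t) e01.
    rewrite /subopt; have [_ /(_ t)[_ <-]] := x_fw.
    by rewrite -[v t - _]opprB dotNr -/g; lra.
  - have [z Fz [q /andP[q0 qr] xz]] := fw_face_offset l_ge2 x_fw Fc Fxs Fv Qt.
    apply: le_trans (xb_le z Fz) _; rewrite xz.
    apply: le_trans (Cnorm_sub_le (Cx Q) Cxs q0) _.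
    by rewrite ler_pM2l.
  (* The factor 2 in [2 * mu]: as [xs] lies in [Cs], the nearest point [xb] is no farther from [x t]
     than [xs] is. *)
  - have := CnormD (xb - x t) (x t - xs) Cc Ct.
    rewrite addrA subrK (CnormC C xb (x t)).
    have := xb_le xs Fxs; have := holder _ (Cx t); rewrite /subopt fmin; lra.
  (* Comparing [v t] with the reflected point gives gap at least
     [dot g (x t - xs) + s * dot g (xb - xs)], and [HB] at [y = x t] bounds the last product below
     by [h - B * dist]. *)
  - move=> s s0; rewrite rho_def => sD.
    have Fw := relint_reflect Ct Cb Fcl xs_relint Fxb s0 sD.
    have := vmin t _ (face_sub Cs_face Fw).
    have := HB _ _ (Cx t) (Cx t); rewrite -/g -/xb ler_norml => /andP[_].
    rewrite !(dotBr, dotZr) => Bxb gv; move: gxs; rewrite dotBr.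
    set h := subopt _ _ _ _ => gxs.
    have := ler_wpM2l s0 (_ : h - B * Cnorm C (x t - xb) <= dot g xb - dot g xs).
    by move=> /(_ ltac:(lra)); lra.
rewrite -/p pmin; split=> [t St|].
  apply: stepsize_recursion => // u Su; exact: step (leq_trans QS Su).
apply: max_stepsize_bigO => //; exact: stepsize_gt0.
Qed.
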